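(* Let $0\le q\le 1/2$. The best known single-letter rate region $\mathcal{R}_{BSL}(q)$ of the binary doubly-dirty multiple access channel $Y=X_1\oplus X_2\oplus S_1\oplus S_2$ with identical input constraints $q_1=q_2=q$ is the triangular region $$\mathcal{R}_{BSL}(q)=\Big\{(R_1,R_2):\ R_1,R_2\ge 0,\ R_1+R_2\le \mathrm{u.c.e.}\,[2H_b(q)-1]^+\Big\},$$ where $\mathrm{u.c.e.}\,[2H_b(q)-1]^+$ denotes the value at $q$ of the upper convex envelope, with respect to $q\in[0,1/2]$, of the function $q\mapsto[2H_b(q)-1]^+$.
   Context: Notation: $\oplus$ is addition mod 2, $H_b(x)=-x\log_2x-(1-x)\log_2(1-x)$ is the binary entropy function, $[x]^+=\max\{0,x\}$, all information quantities are in bits. The upper convex envelope (u.c.e.) of a function is the smallest concave function that is pointwise $\ge$ it on the stated domain. Channel: $Y=X_1\oplus X_2\oplus S_1\oplus S_2$ with all variables in $\{0,1\}$ and $S_1,S_2$ independent Bernoulli$(1/2)$. Pentagonal regions: consider joint distributions of $(S_1,S_2,U_1,U_2,X_1,X_2,Y)$, with $U_1,U_2$ auxiliary random variables in finite alphabets, such that $P(U_1,U_2,X_1,X_2|S_1,S_2)=P(U_1,X_1|S_1)\,P(U_2,X_2|S_2)$ and $Y=X_1\oplus X_2\oplus S_1\oplus S_2$. For such a distribution let $\mathcal{R}(U_1,U_2)$ be the set of pairs $(R_1,R_2)$ with $R_1,R_2\ge0$ and $$R_1\le I(U_1;Y|U_2)-I(U_1;S_1),\quad R_2\le I(U_2;Y|U_1)-I(U_2;S_2),$$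 $$R_1+R_2\le I(U_1,U_2;Y)-I(U_1;S_1)-I(U_2;S_2).$$ Single-letter region with input constraint: $\mathcal{R}_{BSL}(q)$ is the closure of the set of all pairs obtained by time sharing between points of such regions under the input constraints $EX_1\le q$, $EX_2\le q$; that is, all pairs $\sum_{j=1}^k\lambda_j(R_1^{(j)},R_2^{(j)})$ with $k\in\mathbb{N}$, $\lambda_j\ge0$, $\sum_j\lambda_j=1$, where each $(R_1^{(j)},R_2^{(j)})$ belongs to $\mathcal{R}(U_1^{(j)},U_2^{(j)})$ for some joint distribution of $(S_1,S_2,U_1^{(j)},U_2^{(j)},X_1^{(j)},X_2^{(j)},Y^{(j)})$ with $S_1,S_2$ independent Bernoulli$(1/2)$, $U_1^{(j)},U_2^{(j)}$ in finite alphabets, inputs $X_1^{(j)},X_2^{(j)}\in\{0,1\}$, $P(U_1^{(j)},U_2^{(j)},X_1^{(j)},X_2^{(j)}|S_1,S_2)=P(U_1^{(j)},X_1^{(j)}|S_1)\,P(U_2^{(j)},X_2^{(j)}|S_2)$ and $Y^{(j)}=X_1^{(j)}\oplus X_2^{(j)}\oplus S_1\oplus S_2$, and $\sum_j\lambda_j E X_i^{(j)}\le q$ for $i=1,2$. *)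

(* Defs.v *)
From HB Require Import structures.
From mathcomp Require Import all_boot all_order all_algebra.
From mathcomp Require Import all_classical all_reals all_analysis.
Set Implicit Arguments.
Unset Strict Implicit.
Unset Printing Implicit Defensive.
Import Order.TTheory GRing.Theory Num.Theory.
Import numFieldNormedType.Exports.
Local Open Scope classical_set_scope.
Local Open Scope ring_scope.
Local Open Scope convex_scope.

(* [ln 0 = 0] in the library, so the convention [0 * log2 0 = 0] holds. *)
Definition log2 (R : realType) (x : R) : R := ln x / ln 2.

Definition Hb (R : realType) (x : R) : R :=
  - (x * log2 x) - (1 - x) * log2 (1 - x).

Definition pos_part (R : realType) (x : R) : R := Num.max 0 x.

Definition concave_on (R : realType) (D : set R) (f : R -> R) : Prop :=
  convex_function (E := R^o) D (fun x => - f x).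

Definition concave_majorant (R : realType) (D : set R) (f h : R -> R) : Prop :=
  concave_on D h /\ (forall x, D x -> f x <= h x).

(* Upper convex envelope.  [inf] is meaningful only on nonempty sets bounded
   below; [uce_least] shows that, as soon as [f] is bounded above on [D], this
   is the smallest concave function on [D] that is pointwise above [f]. *)
Definition uce (R : realType) (D : set R) (f : R -> R) (x : R) : R :=
  inf [set h x | h in concave_majorant D f].

Lemma uce_least (R : realType) (D : set R) (f : R -> R) (M : R)
    (fM : forall x, D x -> f x <= M) :
  concave_majorant D f (uce D f) /\
  (forall h, concave_majorant D f h -> forall x, D x -> uce D f x <= h x).
Proof.
have cM : concave_majorant D f (fun=> M).
  split=> // t x y _ _ /=.
  by rewrite convRE -mulrDl addrCA subrr addr0 mul1r.
have ne x : [set h x | h in concave_majorant D f] !=set0.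
  by exists M, (fun=> M).
have lb x : D x -> lbound [set h x | h in concave_majorant D f] (f x).
  by move=> Dx _ [h [_ fh] <-]; exact: fh.
have low h x : concave_majorant D f h -> D x -> uce D f x <= h x.
  by move=> ch Dx; apply: ge_inf; [exists (f x); exact: lb | exists h].
split=> [|h ch x Dx]; last exact: low.
split=> [t x y xD yD|x Dx]; last exact/lb_le_inf/lb.
have [Dx Dy] : D x /\ D y by move: xD yD; rewrite !inE.
have cE (a b : R^o) : - a <| t |> - b = - (t%:num * a + (1 - t%:num) * b).
  by rewrite convRE !mulrN -opprD.
rewrite cE lerN2; apply: lb_le_inf => // _ [h ch <-].
have := ch.1 t x y xD yD; rewrite cE lerN2.
apply: le_trans; apply: lerD; apply: ler_wpM2l; rewrite ?low//.
Qed.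

Section FiniteProbability.
Variables (R : realType) (W : finType) (P : W -> R).

Definition is_pmf : Prop := (forall w, 0 <= P w) /\ \sum_w P w = 1.

Definition Pr (A : eqType) (X : W -> A) (a : A) : R := \sum_(w | X w == a) P w.

Definition rv_pair (A B : Type) (X : W -> A) (Y : W -> B) : W -> A * B :=
  fun w => (X w, Y w).

Definition cPr (A B : eqType) (X : W -> A) (Y : W -> B) (a : A) (b : B) : R :=
  Pr (rv_pair X Y) (a, b) / Pr Y b.

(* In the two information quantities, a term with a zero denominator also has
   a zero weight in front of the logarithm. *)
Definition MI (A B : finType) (X : W -> A) (Y : W -> B) : R :=
  \sum_a \sum_b
    Pr (rv_pair X Y) (a, b) *
    log2 (Pr (rv_pair X Y) (a, b) / (Pr X a * Pr Y b)).

Definition cMI (A B C : finType) (X : W -> A) (Y : W -> B) (Z : W -> C) : R :=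
  \sum_a \sum_b \sum_c
    Pr (rv_pair (rv_pair X Y) Z) (a, b, c) *
    log2 (cPr (rv_pair X Y) Z (a, b) c / (cPr X Z a c * cPr Y Z b c)).

Definition expect_bit (X : W -> bool) : R := \sum_w P w * (X w)%:R.

End FiniteProbability.

(* A joint distribution of (S1,S2,U1,U2,X1,X2,Y), presented as random
   variables on an arbitrary finite probability space; [Y] is [dd_Y] below. *)
Record dd_law (R : realType) := DDLaw {
  dd_space : finType;
  dd_pmf : dd_space -> R;
  alph1 : finType;
  alph2 : finType;
  S1 : dd_space -> bool;
  S2 : dd_space -> bool;
  U1 : dd_space -> alph1;
  U2 : dd_space -> alph2;
  X1 : dd_space -> bool;
  X2 : dd_space -> bool;
  pmfP : is_pmf dd_pmf;
  S1_unif : forall s, Pr dd_pmf S1 s = 2^-1;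
  S2_unif : forall s, Pr dd_pmf S2 s = 2^-1;
  S_indep : forall s1 s2,
    Pr dd_pmf (rv_pair S1 S2) (s1, s2) = Pr dd_pmf S1 s1 * Pr dd_pmf S2 s2;
  encoders : forall u1 u2 x1 x2 s1 s2,
    cPr dd_pmf (rv_pair (rv_pair U1 X1) (rv_pair U2 X2)) (rv_pair S1 S2)
      ((u1, x1), (u2, x2)) (s1, s2) =
    cPr dd_pmf (rv_pair U1 X1) S1 (u1, x1) s1 *
    cPr dd_pmf (rv_pair U2 X2) S2 (u2, x2) s2
}.

Definition dd_Y (R : realType) (L : dd_law R) : dd_space L -> bool :=
  fun w => X1 w (+) X2 w (+) S1 w (+) S2 w.

Definition pentagon (R : realType) (L : dd_law R) : set (R * R) :=
  [set r |
    [/\ 0 <= r.1, 0 <= r.2,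
        r.1 <= cMI (@dd_pmf R L) (@U1 R L) (@dd_Y R L) (@U2 R L)
               - MI (@dd_pmf R L) (@U1 R L) (@S1 R L),
        r.2 <= cMI (@dd_pmf R L) (@U2 R L) (@dd_Y R L) (@U1 R L)
               - MI (@dd_pmf R L) (@U2 R L) (@S2 R L) &
        r.1 + r.2 <= MI (@dd_pmf R L) (rv_pair (@U1 R L) (@U2 R L)) (@dd_Y R L)
                     - MI (@dd_pmf R L) (@U1 R L) (@S1 R L)
                     - MI (@dd_pmf R L) (@U2 R L) (@S2 R L)]].

Definition time_shared (R : realType) (q : R) : set (R * R) :=
  [set r | exists (k : nat) (lam : 'I_k -> R) (L : 'I_k -> dd_law R)
             (p : 'I_k -> R * R),
    [/\ (forall j, 0 <= lam j) /\ \sum_j lam j = 1,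
        forall j, pentagon (L j) (p j),
        \sum_j lam j * expect_bit (@dd_pmf R (L j)) (@X1 R (L j)) <= q,
        \sum_j lam j * expect_bit (@dd_pmf R (L j)) (@X2 R (L j)) <= q &
        r = (\sum_j lam j * (p j).1, \sum_j lam j * (p j).2)]].

Definition R_BSL (R : realType) (q : R) : set (R * R) :=
  closure (time_shared q).

(* Main.v *)
(* For one user, let [a] and [b] be the conditional probabilities of [S = 1] and
   of [X (+) S = 1] given [U = u]; then [E X >= E `|a - b|].  Since [Y] is, given
   [(U1, U2)], the sum of the independent bits [X_i (+) S_i], its conditional
   entropy is at least the average of theirs, so the sum rate is at most the
   average over the two users of [E (2 * Hb a - Hb b - 1)].  Pointwise,
   [2 * Hb a - Hb b - 1] is below the envelope at [`|a - b|]: with [qstar] the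
   point where the tangent line of [2 * Hb - 1] passes through the origin, the
   envelope lies above that line on [[0, qstar]] and above [2 * Hb - 1] beyond,
   and both comparisons follow from the fact that [Hb] lies below its tangents.
   Jensen's inequality for the concave nondecreasing envelope concludes.
   Conversely, choosing [U_i = S_i (+) X_i] with [X_i] Bernoulli of parameter
   [t = max(q, qstar)] independent of [S_i], and sharing time with an idle
   channel, reaches every pair below the tangent line at [t], which is a concave
   majorant. *)
Require Import Defs.
From mathcomp Require Import all_boot all_order all_algebra.
From mathcomp Require Import all_classical all_reals all_analysis.
From mathcomp Require Import ring lra.
Import Order.TTheory GRing.Theory Num.Theory.
Import numFieldNormedType.Exports.
Local Open Scope classical_set_scope.
Local Open Scope ring_scope.

(** * The binary entropy function *)

Lemma ln2_gt0 {R : realType} : 0 < ln 2 :> R.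
Proof. by rewrite ln_gt0// ltr1n. Qed.

Lemma log2_1 {R : realType} : log2 1 = 0 :> R.
Proof. by rewrite /log2 ln1 mul0r. Qed.

Lemma log2_2 {R : realType} : log2 2 = 1 :> R.
Proof. by rewrite /log2 divff// gt_eqF// ln2_gt0. Qed.

Lemma log2M {R : realType} (x y : R) :
  0 < x -> 0 < y -> log2 (x * y) = log2 x + log2 y.
Proof. by move=> x0 y0; rewrite /log2 lnM// mulrDl. Qed.

Lemma log2V {R : realType} (x : R) : 0 < x -> log2 x^-1 = - log2 x.
Proof. by move=> x0; rewrite /log2 lnV// mulNr. Qed.

Lemma le_log2 {R : realType} (x y : R) : 0 < x -> x <= y -> log2 x <= log2 y.
Proof.
move=> x0 xy; rewrite /log2 ler_wpM2r ?invr_ge0 ?(ltW ln2_gt0)//.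
by rewrite ler_ln ?posrE// (lt_le_trans x0).
Qed.

Lemma log2_le0 {R : realType} (x : R) : x <= 1 -> log2 x <= 0.
Proof.
by move=> x1; rewrite /log2 mulr_le0_ge0 ?ln_le0// invr_ge0 (ltW ln2_gt0).
Qed.

(** This is [ln z <= z - 1] at [z = t / a], multiplied by [a]. The last hypothesis is absolute
    continuity: it excludes [t = 0 < a], where the default [ln 0 = 0] would spoil the bound. *)
Lemma mul_log2_le {R : realType} (a t : R) : 0 <= a -> 0 <= t ->
  (t = 0 -> a = 0) -> a * (log2 t - log2 a) <= (t - a) / ln 2.
Proof.
move=> a0 t0 ta; rewrite /log2 -mulrBl mulrA.
apply: ler_wpM2r; first by rewrite invr_ge0 (ltW ln2_gt0).
move: a0; rewrite le_eqVlt => /predU1P[<-|a0].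
  by rewrite mul0r subr0.
have {ta}t0 : 0 < t.
  by rewrite lt_neqAle t0 andbT eq_sym; apply/eqP => /ta/eqP; rewrite gt_eqF.
rewrite -ln_div ?posrE//.
have -> : t - a = a * (t / a - 1).
  by rewrite mulrBr mulr1 mulrCA divff ?gt_eqF// mulr1.
rewrite ler_wpM2l ?(ltW a0)//.
have := @le_ln1Dx R (t / a - 1); rewrite addrCA subrr addr0; apply.
by rewrite ltrBDr addrC subrr divr_gt0.
Qed.

Lemma HbC {R : realType} (x : R) : Hb (1 - x) = Hb x.
Proof. by rewrite /Hb subKr; ring. Qed.

Lemma Hb0 {R : realType} : Hb 0 = 0 :> R.
Proof. by rewrite /Hb subr0 log2_1 mul0r mulr0 subr0 oppr0. Qed.

Lemma Hb1 {R : realType} : Hb 1 = 0 :> R.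
Proof. by rewrite -HbC subrr Hb0. Qed.

Lemma Hb_half {R : realType} : Hb 2^-1 = 1 :> R.
Proof.
rewrite /Hb; have -> : 1 - 2^-1 = 2^-1 :> R by lra.
by rewrite log2V// log2_2; lra.
Qed.

Lemma Hb_ge0 {R : realType} (x : R) : 0 <= x <= 1 -> 0 <= Hb x.
Proof.
move=> /andP[x0 x1].
have := log2_le0 x x1; have := log2_le0 (1 - x) ltac:(by lra).
by rewrite /Hb; nra.
Qed.

(** Gibbs' inequality for two bits: the previous bound is applied to [(x, t)] and to
    [(1 - x, 1 - t)], and the two right-hand sides cancel. *)
Lemma Hb_cross_entropy {R : realType} (x t : R) : 0 <= x <= 1 -> 0 <= t <= 1 ->
  (t = 0 -> x = 0) -> (t = 1 -> x = 1) ->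
  Hb x <= - (x * log2 t) - (1 - x) * log2 (1 - t).
Proof.
move=> /andP[x0 x1] /andP[t0 t1] tx0 tx1.
have e1 := mul_log2_le _ _ x0 t0 tx0.
have : (1 - x) * (log2 (1 - t) - log2 (1 - x)) <= (1 - t - (1 - x)) / ln 2.
  by apply: mul_log2_le; rewrite ?subr_ge0// => ?; rewrite tx1; lra.
have -> : (1 - t - (1 - x)) / ln 2 = - ((t - x) / ln 2) by ring.
by rewrite /Hb; move: e1; lra.
Qed.

(** As a function of [x], the cross-entropy against a fixed [t] is affine and touches [Hb] at [t];
    it is the tangent line there. *)
Lemma Hb_le_tangent {R : realType} (x t : R) : 0 <= x <= 1 -> 0 < t < 1 ->
  Hb x <= - log2 (1 - t) + x * (log2 (1 - t) - log2 t).
Proof.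
move=> x01 /andP[t0 t1]; apply: (le_trans (Hb_cross_entropy x t x01 _ _ _)); lra.
Qed.

(** Both entropies are bounded by the cross-entropy against the mean [t], and these bounds average
    to [Hb t]. The weights 0 and 1 are split off so that [t] at an endpoint forces [x] and [y] to be
    there too. *)
Lemma Hb_concave {R : realType} (l x y : R) : 0 <= l <= 1 -> 0 <= x <= 1 ->
  0 <= y <= 1 -> l * Hb x + (1 - l) * Hb y <= Hb (l * x + (1 - l) * y).
Proof.
move=> /andP[l0 l1] x01 y01; set t := l * x + (1 - l) * y.
move: l0; rewrite le_eqVlt => /predU1P[l0|l0].
  by rewrite /t -l0 !(mul0r, subr0, add0r, mul1r).
move: l1; rewrite le_eqVlt => /predU1P[l1|l1].
  by rewrite /t l1 !(subrr, mul0r, addr0, mul1r).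
have t01 : 0 <= t <= 1 by rewrite /t; nra.
have e1 : Hb x <= - (x * log2 t) - (1 - x) * log2 (1 - t).
  by apply: Hb_cross_entropy => //; rewrite /t; nra.
have e2 : Hb y <= - (y * log2 t) - (1 - y) * log2 (1 - t).
  by apply: Hb_cross_entropy => //; rewrite /t; nra.
have -> : Hb t = l * (- (x * log2 t) - (1 - x) * log2 (1 - t)) +
    (1 - l) * (- (y * log2 t) - (1 - y) * log2 (1 - t)).
  by rewrite /Hb /t; ring.
by apply: lerD; rewrite ler_wpM2l//; lra.
Qed.

Lemma Hb_le1 {R : realType} (x : R) : 0 <= x <= 1 -> Hb x <= 1.
Proof.
move=> x01; apply: (le_trans (Hb_le_tangent x 2^-1 x01 _)); first by lra.
have -> : 1 - 2^-1 = 2^-1 :> R by lra.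
by rewrite log2V// log2_2; lra.
Qed.

(** The argument on the right mixes [1 - y] and [y] with weights [x] and [1 - x], and both points
    have entropy [Hb y]: adding an independent bit cannot lower entropy. *)
Lemma Hb_binary_convolution {R : realType} (x y : R) :
  0 <= x <= 1 -> 0 <= y <= 1 -> Hb y <= Hb (x * (1 - y) + (1 - x) * y).
Proof.
move=> x01 y01; apply: le_trans (Hb_concave x (1 - y) y _ _ _) => //; last by lra.
by rewrite HbC; lra.
Qed.

(* The positive root of [Hb x - 1 / 2 = x * Hb' x], i.e. of
   [log2 (1 - x) = - 1 / 2]: the abscissa where the tangent through the origin
   touches the graph of [2 * Hb - 1]. *)
Definition qstar {R : realType} : R := 1 - (Num.sqrt 2)^-1.

Definition Hb' {R : realType} (t : R) : R := log2 (1 - t) - log2 t.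

Lemma invsqrt2 {R : realType} (s := (Num.sqrt 2)^-1 : R) : 0 < s /\ s * s = 2^-1.
Proof.
split; first by rewrite invr_gt0 sqrtr_gt0.
by rewrite /s -expr2 exprVn sqr_sqrtr.
Qed.

Lemma qstar_bounds {R : realType} : 4^-1 <= (qstar : R) <= 3^-1.
Proof. by rewrite /qstar; have [] := @invsqrt2 R; set s := _^-1; nra. Qed.

Lemma log2_invsqrt2 {R : realType} : log2 (Num.sqrt 2)^-1 = - 2^-1 :> R.
Proof.
have [s0 ss] := @invsqrt2 R.
have := log2M _ _ s0 s0; rewrite ss log2V// log2_2; lra.
Qed.

Lemma log2_1Bqstar {R : realType} : log2 (1 - qstar) = - 2^-1 :> R.
Proof. by rewrite /qstar subKr log2_invsqrt2. Qed.

Lemma Hb'_qstar_bounds {R : realType} : 1 <= Hb' (qstar : R) <= 3 / 2.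
Proof.
have /andP[q1 q2] := @qstar_bounds R.
rewrite /Hb' log2_1Bqstar.
have l4 : log2 4^-1 = - 2 :> R.
  have -> : 4 = 2 * 2 :> R by lra.
  by rewrite log2V ?log2M ?mulr_gt0// log2_2; lra.
have := le_log2 4^-1 qstar _ q1; rewrite l4 => /(_ ltac:(by lra)) e1.
(* The right-hand side is [- 3 / 2]; with [log2 (1 - qstar) = - 1 / 2] this gives the lower bound
   1. *)
suff : log2 qstar <= log2 (2^-1 * (Num.sqrt 2)^-1 :> R).
  have [s0 _] := @invsqrt2 R.
  by rewrite log2M// log2_invsqrt2 log2V// log2_2; lra.
apply: le_log2; first by lra.
by rewrite /qstar; have [] := @invsqrt2 R; set s := _^-1; nra.
Qed.

(** The tangency condition at [qstar], rewritten: [2 * Hb qstar - 1] is [qstar] times the slope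
    [2 * Hb' qstar]. *)
Lemma Hb_qstar {R : realType} : Hb qstar = 2^-1 + qstar * Hb' qstar :> R.
Proof.
by have := @log2_1Bqstar R; rewrite /Hb' /Hb => ->; lra.
Qed.

(** Concavity between [qstar] and [1 - qstar], which have the same entropy. *)
Lemma Hb_qstar_le_middle {R : realType} (x : R) :
  qstar <= x <= 1 - qstar -> Hb qstar <= Hb x.
Proof.
move=> /andP[x1 x2]; have /andP[q1 q2] := @qstar_bounds R.
have c0 : 0 < 1 - 2 * qstar :> R by lra.
pose l : R := (1 - qstar - x) / (1 - 2 * qstar).
have l01 : 0 <= l <= 1.
  by rewrite /l divr_ge0 ?(ltW c0)//=; [rewrite ler_pdivrMr//; lra | lra].
have := Hb_concave l qstar (1 - qstar) l01 _ _.
have -> : l * qstar + (1 - l) * (1 - qstar) = x.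
  by rewrite /l; field; rewrite gt_eqF.
rewrite HbC; move=> /(_ ltac:(by lra) ltac:(by lra)); lra.
Qed.

Lemma Hb_qstar_ge {R : realType} : 2 / 3 <= Hb qstar :> R.
Proof.
rewrite Hb_qstar.
by have /andP[? ?] := @qstar_bounds R; have /andP[? ?] := @Hb'_qstar_bounds R; nra.
Qed.

(** By concavity [Hb] lies above its chord on [[0, qstar]]. That chord has slope
    [Hb' qstar + 1 / (2 * qstar)], which is at least [2 * Hb' qstar] because [qstar <= 1 / 3] and
    [Hb' qstar <= 3 / 2]. *)
Lemma chord_le_Hb {R : realType} (x : R) :
  0 <= x <= qstar -> 2 * Hb' qstar * x <= Hb x.
Proof.
move=> /andP[x0 x1]; have /andP[q1 q2] := @qstar_bounds R.
have /andP[m1 m2] := @Hb'_qstar_bounds R.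
have q0 : 0 < qstar :> R by lra.
pose l : R := x / qstar.
have l01 : 0 <= l <= 1 by rewrite /l divr_ge0 ?(ltW q0)//= ler_pdivrMr// mul1r.
have := Hb_concave l qstar 0 l01 _ _.
have -> : l * qstar + (1 - l) * 0 = x by rewrite mulr0 addr0 divfK ?gt_eqF.
rewrite Hb0 mulr0 addr0 => /(_ ltac:(by lra) ltac:(by lra)).
apply: le_trans.
have -> : 2 * Hb' qstar * x = l * (2 * Hb' qstar * qstar).
  by rewrite /l; field; rewrite gt_eqF.
by rewrite ler_wpM2l//; [lra|rewrite Hb_qstar; nra].
Qed.

Lemma Hb'_nincr {R : realType} (x y : R) : 0 < x -> x <= y -> y < 1 ->
  Hb' y <= Hb' x.
Proof. by move=> x0 xy y1; rewrite /Hb' lerB// le_log2//; lra. Qed.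

Lemma Hb_le_tangent_at {R : realType} (x t : R) : 0 <= x <= 1 -> 0 < t < 1 ->
  Hb x <= Hb t + (x - t) * Hb' t.
Proof.
move=> x01 t01; apply: le_trans (Hb_le_tangent _ _ x01 t01) _.
by rewrite /Hb /Hb'; lra.
Qed.

(** * Pointwise bounds on the contribution of one user *)

(** For [b <= qstar], the tangent at [qstar] bounds [Hb a] and the chord bounds [Hb b] from below.
    For larger [b], the tangent at [b] leaves [Hb b - 1 <= 0] plus a multiple of [a - b] whose slope
    is at most the one at [qstar]. *)
Lemma encoder_bound_linear_le {R : realType} (a b : R) :
  0 <= b -> b <= a -> a <= 1 ->
  2 * Hb a - Hb b - 1 <= 2 * Hb' qstar * (a - b).
Proof.
move=> b0 ba a1.
have /andP[q1 q2] := @qstar_bounds R; have /andP[m1 m2] := @Hb'_qstar_bounds R.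
have [bq|qb] := leP b qstar.
  have h1 := chord_le_Hb b ltac:(by lra).
  have := Hb_le_tangent_at a qstar ltac:(by lra) ltac:(by lra).
  by rewrite Hb_qstar; nra.
have [b1|b1] := leP 1 b.
  have -> : a = 1 by lra. have -> : b = 1 by lra. by rewrite Hb1; lra.
have h1 := Hb_le_tangent_at a b ltac:(by lra) ltac:(by lra).
have h2 := Hb'_nincr qstar b ltac:(by lra) ltac:(by lra) b1.
have h3 := Hb_le1 b ltac:(by lra).
by nra.
Qed.

Lemma encoder_bound_curve_le {R : realType} (a b : R) :
  0 <= b -> b <= a -> a <= 1 -> qstar <= a - b ->
  2 * Hb a - Hb b - 1 <= 2 * Hb (Num.min (a - b) 2^-1) - 1.
Proof.
move=> b0 ba a1 qd.
have /andP[q1 q2] := @qstar_bounds R; have /andP[m1 m2] := @Hb'_qstar_bounds R.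
have h1 := Hb_le1 a ltac:(by lra).
have h2 := Hb_ge0 b ltac:(by lra).
have [d2|d2] := lerP (a - b) 2^-1; last by rewrite Hb_half; lra.
have [bq|qb] := leP b qstar.
  have h3 := chord_le_Hb b ltac:(by lra).
  have h4 := Hb_le_tangent_at a (a - b) ltac:(by lra) ltac:(by lra).
  have h5 := Hb'_nincr qstar (a - b) ltac:(by lra) ltac:(by lra) ltac:(by lra).
  (* The tangent at [a - b] costs at most [2 * b * Hb' qstar], which the chord bound on [Hb b] pays
     back. *)
  by nra.
(* Now [b] and [a - b] both lie in the middle interval, with entropies at least 2/3: the left side
   is at most 2 - 2/3 - 1 = 1/3, and the right side at least 4/3 - 1 = 1/3. *)
have h6 := @Hb_qstar_ge R.
have h7 := Hb_qstar_le_middle b ltac:(by lra).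
have h8 := Hb_qstar_le_middle (a - b) ltac:(by lra).
by lra.
Qed.

(** * The upper envelope *)

Lemma concave_onP {R : realType} {D : set R} {f : R -> R} {l x y : R} :
  concave_on D f -> 0 <= l <= 1 -> D x -> D y ->
  l * f x + (1 - l) * f y <= f (l * x + (1 - l) * y).
Proof.
move=> cf /andP[l0 l1] Dx Dy.
have := cf (Itv01 l0 l1) x y; rewrite !inE => /(_ Dx Dy).
by rewrite !convRE /= !mulrN -opprD lerN2.
Qed.

(* The conclusion is scaled by the total weight so that the induction survives
   a vanishing total weight. *)
Lemma concave_on_sum {R : realType} {a b : R} {f : R -> R} {I : Type}
    {s : seq I} {w x : I -> R} : concave_on `[a, b] f ->
  a <= b -> (forall i, 0 <= w i) -> (forall i, a <= x i <= b) ->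
  exists y, [/\ a <= y <= b, \sum_(i <- s) w i * x i = (\sum_(i <- s) w i) * y &
    \sum_(i <- s) w i * f (x i) <= (\sum_(i <- s) w i) * f y].
Proof.
move=> cf ab w0 xab; elim: s => [|i s [y [yab sy fy]]].
  by exists a; rewrite !big_nil !mul0r lexx.
have W0 : 0 <= \sum_(j <- s) w j by exact: sumr_ge0.
rewrite !big_cons; move: sy fy W0; set W := \sum_(j <- s) w j => sy fy W0.
have := w0 i; have := xab i; set wi := w i; set xi := x i => xiab wi0.
have [W'0|W'0] := leP (wi + W) 0.
  have wi00 : wi = 0 by lra.
  have W00 : W = 0 by lra.
  by exists y; split=> //; [rewrite sy wi00; ring|rewrite wi00 !add0r mul0r add0r].
pose l := wi / (wi + W).
have lW : (wi + W) * l = wi by rewrite /l mulrC divfK// gt_eqF.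
have lW' : (wi + W) * (1 - l) = W by rewrite mulrBr lW; ring.
have l01 : 0 <= l <= 1.
  by rewrite /l divr_ge0 ?(ltW W'0)//= ler_pdivrMr// mul1r lerDl.
clearbody l; exists (l * xi + (1 - l) * y); split.
- by clear -l01 xiab yab; nra.
- by rewrite sy mulrDr !mulrA lW lW'.
- have := concave_onP cf l01 (_ : `[a, b]%classic xi) (_ : `[a, b]%classic y).
  rewrite /= !in_itv /= => /(_ xiab yab) h.
  apply: le_trans (_ : (wi + W) * (l * f xi + (1 - l) * f y) <= _).
    by rewrite mulrDr !mulrA lW lW' lerD2l.
  by rewrite ler_wpM2l// ltW.
Qed.

Lemma concave_on_jensen {R : realType} {a b : R} {f : R -> R} {I : finType}
    {w x : I -> R} : concave_on `[a, b] f ->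
  (forall i, 0 <= w i) -> \sum_i w i = 1 -> (forall i, a <= x i <= b) ->
  a <= \sum_i w i * x i <= b /\
  \sum_i w i * f (x i) <= f (\sum_i w i * x i).
Proof.
move=> cf w0 w1 xab.
have ab : a <= b.
  case: (pickP I) => [i _|I0]; first by have := xab i; lra.
  by move: w1; rewrite big_pred0// => /esym/eqP; rewrite oner_eq0.
have [y [yab sy fy]] := concave_on_sum (s := index_enum I) cf ab w0 xab.
by rewrite sy w1 !mul1r in fy *.
Qed.

(** * Properties of the envelope of the rate function *)

Notation rate_envelope :=
  (uce `[0, 2^-1] (fun x : _ => pos_part (2 * Hb x - 1))).

Lemma rate_le1 {R : realType} (x : R) : `[0, 2^-1]%classic x ->
  pos_part (2 * Hb x - 1) <= 1.
Proof.
rewrite /= in_itv/= => x01; rewrite /pos_part ge_max ler01/=.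
by have := Hb_le1 x ltac:(lra); lra.
Qed.

Lemma rate_envelope_concave {R : realType} :
  concave_on `[0, 2^-1] (rate_envelope : R -> R).
Proof. exact: (uce_least (@rate_le1 R)).1.1. Qed.

Lemma rate_envelope_ge {R : realType} (x : R) : 0 <= x <= 2^-1 ->
  0 <= rate_envelope x /\ 2 * Hb x - 1 <= rate_envelope x.
Proof.
move=> x0; have := (uce_least (@rate_le1 R)).1.2 x; rewrite /= in_itv/= => /(_ x0).
by rewrite /pos_part ge_max => /andP[].
Qed.

Lemma affine_concave_on {R : realType} (D : set R) (a b : R) :
  concave_on D (fun x => a + x * b).
Proof.
move=> t x y _ _.
have -> : conv t x y = t%:num * x + (1 - t%:num) * y by exact: (@convRE R x y t).
rewrite convRE /unstable.onem.
by rewrite le_eqVlt; apply/orP; left; apply/eqP; ring.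
Qed.

Lemma rate_envelope_le_affine {R : realType} (a b x : R) :
  (forall y, 0 <= y <= 2^-1 -> pos_part (2 * Hb y - 1) <= a + y * b) ->
  0 <= x <= 2^-1 -> rate_envelope x <= a + x * b.
Proof.
move=> ab x01.
apply: ((uce_least (@rate_le1 R)).2 (fun x => a + x * b)).
  by split=> [|y]; [exact: affine_concave_on|rewrite /= in_itv/=; exact: ab].
by rewrite /= in_itv.
Qed.

Lemma rate_envelope_le1 {R : realType} (x : R) :
  0 <= x <= 2^-1 -> rate_envelope x <= 1.
Proof.
move=> x01; have := @rate_envelope_le_affine R 1 0 x; rewrite mulr0 addr0; apply=> //.
by move=> y y01; rewrite mulr0 addr0 rate_le1//= in_itv.
Qed.

Lemma rate_envelope_half {R : realType} : rate_envelope 2^-1 = 1 :> R.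
Proof.
have h : 0 <= (2^-1 : R) <= 2^-1 by lra.
apply/eqP; rewrite eq_le rate_envelope_le1//=.
by have [_] := @rate_envelope_ge R 2^-1 h; rewrite Hb_half; lra.
Qed.

(** The envelope reaches its maximum 1 at [2^-1], and [y] lies between [x] and that point, so
    concavity suffices. *)
Lemma rate_envelope_nondecreasing {R : realType} (x y : R) :
  0 <= x -> x <= y -> y <= 2^-1 -> rate_envelope x <= rate_envelope y.
Proof.
move=> x0 xy y1; have [x1|x1] := leP 2^-1 x.
  by have -> : x = y by lra.
have c0 : 0 < 2^-1 - x by lra.
pose l := (2^-1 - y) / (2^-1 - x).
have l01 : 0 <= l <= 1.
  by rewrite /l divr_ge0 ?(ltW c0)//=; [rewrite ler_pdivrMr//; lra|lra].
have := concave_onP (@rate_envelope_concave R) l01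
  (_ : `[0, 2^-1]%classic x) (_ : `[0, 2^-1]%classic 2^-1).
rewrite /= !in_itv/= => /(_ ltac:(by lra) ltac:(by lra)).
have -> : l * x + (1 - l) * 2^-1 = y by rewrite /l; field; lra.
rewrite rate_envelope_half; apply: le_trans.
by have := @rate_envelope_le1 R x ltac:(by lra); nra.
Qed.

(** Concavity between 0, where the envelope is nonnegative, and [qstar], where it is at least
    [2 * Hb qstar - 1 = 2 * qstar * Hb' qstar]. *)
Lemma rate_envelope_ge_chord {R : realType} (x : R) :
  0 <= x <= qstar -> 2 * Hb' qstar * x <= rate_envelope x.
Proof.
move=> /andP[x0 xq]; have /andP[q1 q2] := @qstar_bounds R.
have q0 : 0 < qstar :> R by lra.
pose l := x / qstar.
have l01 : 0 <= l <= 1 by rewrite /l divr_ge0 ?(ltW q0)//= ler_pdivrMr// mul1r.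
have := concave_onP (@rate_envelope_concave R) l01
  (_ : `[0, 2^-1]%classic qstar) (_ : `[0, 2^-1]%classic 0).
rewrite /= !in_itv/= => /(_ ltac:(by lra) ltac:(by lra)).
have lq : l * qstar = x by rewrite /l divfK ?gt_eqF.
rewrite lq mulr0 addr0; apply: le_trans.
have [e0 _] := @rate_envelope_ge R 0 ltac:(by lra).
have [_ eq] := @rate_envelope_ge R qstar ltac:(by lra).
rewrite -lq.
apply: le_trans (_ : l * rate_envelope qstar <= _); last by nra.
rewrite [leLHS]mulrCA ler_wpM2l//; first by lra.
by apply: le_trans eq; rewrite Hb_qstar; lra.
Qed.

Lemma encoder_bound_le {R : realType} (a b : R) :
  0 <= b -> b <= a -> a <= 1 ->
  2 * Hb a - Hb b - 1 <= rate_envelope (Num.min (a - b) 2^-1).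
Proof.
move=> b0 ba a1; have /andP[q1 q2] := @qstar_bounds R.
have [d|d] := leP (a - b) qstar.
  have -> : Num.min (a - b) 2^-1 = a - b by apply: min_l; lra.
  apply: le_trans (encoder_bound_linear_le a b b0 ba a1) _.
  by apply: rate_envelope_ge_chord; lra.
apply: le_trans (encoder_bound_curve_le a b b0 ba a1 (ltW d)) _.
by apply: (rate_envelope_ge _ _).2; rewrite le_min ge_min; lra.
Qed.

(** Replacing [a] and [b] by their complements keeps both entropies and the distance, which reduces
    the claim to [b <= a]. The cap at [2^-1] keeps the argument in the domain where the envelope is
    meaningful. *)
Lemma encoder_bound {R : realType} (a b : R) : 0 <= a <= 1 -> 0 <= b <= 1 ->
  2 * Hb a - Hb b - 1 <= rate_envelope (Num.min `|a - b| 2^-1).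
Proof.
move=> a01 b01; have [ba|ab] := leP b a.
  by rewrite ger0_norm ?subr_ge0//; apply: encoder_bound_le; lra.
rewrite ltr0_norm ?subr_lt0//.
have := @encoder_bound_le R (1 - a) (1 - b) ltac:(lra) ltac:(lra) ltac:(lra).
by rewrite !HbC; have -> : 1 - a - (1 - b) = - (a - b) by lra.
Qed.

(* The majorant is the tangent line of [2 * Hb - 1] at [Num.max q qstar]; for
   [q < qstar] it passes through the origin. *)
Lemma rate_envelope_le {R : realType} (q t : R) : 0 <= q -> q <= 2^-1 ->
  t = Num.max q qstar -> rate_envelope q <= q / t * (2 * Hb t - 1).
Proof.
move=> q0 q1 tE; have /andP[b1 b2] := @qstar_bounds R.
have tq : qstar <= t by rewrite tE le_max lexx orbT.
have t1 : t <= 2^-1 by rewrite tE ge_max q1; lra.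
have t0 : 0 < t by lra.
have Ht : Hb t = - log2 (1 - t) + t * Hb' t by rewrite /Hb /Hb'; ring.
have m0 : 0 <= Hb' t by rewrite /Hb' subr_ge0 le_log2//; lra.
(* This makes the intercept of the tangent nonnegative, so that the line also dominates the zero
   branch of [pos_part]. *)
have l1 : log2 (1 - t) <= - 2^-1.
  by rewrite -(@log2_1Bqstar R) le_log2//; lra.
apply: le_trans (_ : (- 2 * log2 (1 - t) - 1) + q * (2 * Hb' t) <= _).
  apply: rate_envelope_le_affine; last by lra.
  move=> y y01; rewrite /pos_part ge_max; apply/andP; split; first by nra.
  have := @Hb_le_tangent R y t ltac:(lra) ltac:(lra); rewrite -/(Hb' t); lra.
have [tq'|tq'] := leP q qstar.
  have -> : t = qstar by rewrite tE; apply: max_r.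
  rewrite Hb_qstar log2_1Bqstar.
  have -> : q / qstar * (2 * (2^-1 + qstar * Hb' qstar) - 1) = q * (2 * Hb' qstar).
    by field; lra.
  by lra.
have tEq : t = q by rewrite tE; apply: max_l; lra.
rewrite -tEq divff ?gt_eqF// mul1r Ht; lra.
Qed.

(** * Upper bound on the sum rate *)

Lemma mul_log2_div {R : realType} (x y : R) : 0 <= x -> 0 < y ->
  x * log2 (x / y) = x * (log2 x - log2 y).
Proof.
rewrite le_eqVlt => /predU1P[<-|x0] y0; first by rewrite !mul0r.
by rewrite log2M ?invr_gt0// log2V.
Qed.

Lemma mul_HbE {R : realType} (x y : R) : 0 <= x -> 0 <= y ->
  (x + y) * Hb (x / (x + y)) =
  - (x * (log2 x - log2 (x + y)) + y * (log2 y - log2 (x + y))).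
Proof.
move=> x0 y0; have := addr_ge0 x0 y0; rewrite le_eqVlt => /predU1P[xy|xy].
  have -> : x = 0 by lra. have -> : y = 0 by lra. by rewrite addr0 !mul0r; lra.
rewrite -!mul_log2_div//.
by rewrite /Hb; have -> : 1 - x / (x + y) = y / (x + y) by [field; lra]; field; lra.
Qed.

(** * Marginals and mutual information on finite spaces *)

Lemma PrE {R : realType} {W : finType} (P : W -> R) {A : eqType} (X : W -> A) a :
  Pr P X a = \sum_w P w * (X w == a)%:R.
Proof.
rewrite /Pr big_mkcond; apply: eq_bigr => w _.
by case: eqP; rewrite ?mulr1 ?mulr0.
Qed.

Lemma Pr_ge0 {R : realType} {W : finType} {P : W -> R} {A : eqType} (X : W -> A) a :
  is_pmf P -> 0 <= Pr P X a.
Proof. by move=> [P0 _]; exact: sumr_ge0. Qed.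

Lemma sum_Pr_mul {R : realType} {W : finType} (P : W -> R) {A : finType}
    (X : W -> A) (g : A -> R) : \sum_a Pr P X a * g a = \sum_w P w * g (X w).
Proof.
rewrite [RHS](partition_big X predT)//=; apply: eq_bigr => a _.
by rewrite /Pr mulr_suml; apply: eq_bigr => w /eqP ->.
Qed.

Lemma sum_Pr {R : realType} {W : finType} {P : W -> R} {A : finType} (X : W -> A) :
  is_pmf P -> \sum_a Pr P X a = 1.
Proof.
move=> [_ P1]; under eq_bigr => a _ do rewrite -[Pr P X a]mulr1.
by rewrite (sum_Pr_mul P X (fun=> 1)); under eq_bigr => w _ do rewrite mulr1.
Qed.

Lemma Pr_comp {R : realType} {W : finType} (P : W -> R) {A : finType} {B : eqType}
    (X : W -> A) (f : A -> B) b :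
  Pr P (f \o X) b = \sum_(a | f a == b) Pr P X a.
Proof.
rewrite PrE -(sum_Pr_mul P X (fun a => (f a == b)%:R)) [RHS]big_mkcond.
by apply: eq_bigr => a _; case: eqP; rewrite ?mulr1 ?mulr0.
Qed.

Lemma Pr_fst {R : realType} {W : finType} (P : W -> R) {A : eqType} {B : finType}
    (X : W -> A) (Y : W -> B) a :
  Pr P X a = \sum_b Pr P (rv_pair X Y) (a, b).
Proof.
by rewrite /Pr (partition_big Y predT).
Qed.

Lemma Pr_snd {R : realType} {W : finType} (P : W -> R) {A : finType} {B : eqType}
    (X : W -> A) (Y : W -> B) b :
  Pr P Y b = \sum_a Pr P (rv_pair X Y) (a, b).
Proof.
rewrite /Pr (partition_big X predT)//=; apply: eq_bigr => a _.
by apply: eq_bigl => w; rewrite xpair_eqE andbC.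
Qed.

Lemma Pr_fst_bool {R : realType} {W : finType} (P : W -> R) {A : eqType}
    (X : W -> A) (Y : W -> bool) a :
  Pr P X a = Pr P (rv_pair X Y) (a, true) + Pr P (rv_pair X Y) (a, false).
Proof. by rewrite (Pr_fst P X Y) big_bool. Qed.

Lemma Pr_ratio01 {R : realType} {W : finType} {P : W -> R} {A : eqType}
    (X : W -> A) (Y : W -> bool) a : is_pmf P ->
  0 <= Pr P (rv_pair X Y) (a, true) / Pr P X a <= 1.
Proof.
move=> Pp; have := Pr_ge0 (rv_pair X Y) (a, true) Pp.
have := Pr_ge0 (rv_pair X Y) (a, false) Pp; rewrite (Pr_fst_bool P X Y).
move: (Pr _ _ _) (Pr _ _ _) => y x y0 x0.
have := addr_ge0 x0 y0; rewrite le_eqVlt => /predU1P[<-|xy].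
  by rewrite invr0 mulr0 lexx ler01.
by rewrite divr_ge0 ?(ltW xy)//= ler_pdivrMr// mul1r lerDl.
Qed.

(** The identity I(X;Y) = H(Y) - H(Y|X) for a bit Y; it turns the information terms of the sum rate
    into binary entropies. *)
Lemma MI_boolE {R : realType} {W : finType} {P : W -> R} {A : finType}
    (X : W -> A) (Y : W -> bool) : is_pmf P ->
  MI P X Y = Hb (Pr P Y true) -
    \sum_a Pr P X a * Hb (Pr P (rv_pair X Y) (a, true) / Pr P X a).
Proof.
move=> Pp; set p := Pr P (rv_pair X Y).
have p0 ab : 0 <= p ab by exact: Pr_ge0.
have pX a : Pr P X a = p (a, true) + p (a, false) by exact: Pr_fst_bool.
have pY b : Pr P Y b = \sum_a p (a, b) by exact: Pr_snd.
(* Where the joint weight is positive, so are both marginals and the logarithm splits; elsewhere the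
   factor in front vanishes. *)
have split_log a b : p (a, b) * log2 (p (a, b) / (Pr P X a * Pr P Y b)) =
    p (a, b) * (log2 (p (a, b)) - log2 (Pr P X a)) - p (a, b) * log2 (Pr P Y b).
  have := p0 (a, b); rewrite le_eqVlt => /predU1P[<-|pab]; first by rewrite !mul0r subr0.
  have X0 : 0 < Pr P X a.
    have := p0 (a, true); have := p0 (a, false); rewrite pX.
    by case: b pab; lra.
  have Y0 : 0 < Pr P Y b.
    by rewrite pY (bigD1 a)//= ltr_pwDl// sumr_ge0.
  by rewrite mul_log2_div ?mulr_gt0// log2M//; ring.
have HY : Hb (Pr P Y true) = - \sum_b Pr P Y b * log2 (Pr P Y b).
  have Y1 : Pr P Y true + Pr P Y false = 1 by rewrite -(sum_Pr Y Pp) big_bool.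
  rewrite big_bool/= /Hb; have -> : 1 - Pr P Y true = Pr P Y false by lra.
  by rewrite opprD.
rewrite HY /MI.
under eq_bigr => a _ do (under eq_bigr => b _ do rewrite split_log).
under eq_bigr => a _ do rewrite sumrB.
rewrite sumrB [X in _ - X]exchange_big/= [LHS]addrC.
congr (- _ + _).
  by apply: eq_bigr => b _; rewrite pY mulr_suml.
rewrite -sumrN; apply: eq_bigr => a _.
by rewrite big_bool/= pX mul_HbE// opprK.
Qed.

Definition indep {R : realType} {W : finType} (P : W -> R) {A B : eqType}
    (X : W -> A) (Y : W -> B) :=
  forall a b, Pr P (rv_pair X Y) (a, b) = Pr P X a * Pr P Y b.

Lemma indep_comp {R : realType} {W : finType} (P : W -> R) {A B : finType}
    {C D : eqType} (X : W -> A) (Y : W -> B) (f : A -> C) (g : B -> D) :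
  indep P X Y -> indep P (f \o X) (g \o Y).
Proof.
move=> XY c d; rewrite !Pr_comp.
have -> : rv_pair (f \o X) (g \o Y) = (fun ab => (f ab.1, g ab.2)) \o rv_pair X Y by [].
rewrite Pr_comp big_distrlr/= pair_big/=.
by apply: eq_big => [[a b]|[a b] _]; rewrite ?xpair_eqE//= XY.
Qed.

(** The bits [S] and [T] differ exactly where [X] is 1, so on each outcome the difference of their
    indicators is bounded by that of [X]. *)
Lemma cost_ge {R : realType} {W : finType} {P : W -> R} {A : finType}
    (U : W -> A) (S X : W -> bool) (T := fun w => X w (+) S w) (u : A) : is_pmf P ->
  Pr P U u * `|Pr P (rv_pair U S) (u, true) / Pr P U u -
               Pr P (rv_pair U T) (u, true) / Pr P U u| <=
  Pr P (rv_pair U X) (u, true).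
Proof.
move=> Pp; have U0 := Pr_ge0 U u Pp; have [P0 _] := Pp.
rewrite -mulrBl normrM [X in _ * (_ * X)]ger0_norm ?invr_ge0// mulrCA.
apply: le_trans (_ : `|Pr P (rv_pair U S) (u, true) - Pr P (rv_pair U T) (u, true)| <= _).
  have [->|n0] := eqVneq (Pr P U u) 0; first by rewrite mul0r mulr0.
  by rewrite divff// mulr1.
rewrite !PrE -sumrB (le_trans (ler_norm_sum _ _ _))//; apply: ler_sum => w _.
rewrite -mulrBr normrM (ger0_norm (P0 w)) ler_wpM2l// /rv_pair /T !xpair_eqE.
by case: (U w == u); case: (S w); case: (X w);
  rewrite /= ?(subrr, normr0, subr0, sub0r, normrN1, normr1).
Qed.

Lemma expect_bitE {R : realType} {W : finType} (P : W -> R) (X : W -> bool) :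
  expect_bit P X = Pr P X true.
Proof. by rewrite PrE /expect_bit; apply: eq_bigr => w _; rewrite eqb_id. Qed.

(** The left side is 2 H(S|U) - H(T|U) - 1. The pointwise bound is averaged over [U] by Jensen's
    inequality, then the mean distance is replaced by the larger cost using monotonicity. *)
Lemma user_bound {R : realType} {W : finType} {P : W -> R} {A : finType}
    (U : W -> A) (S X : W -> bool) (T := fun w => X w (+) S w) : is_pmf P ->
  \sum_u Pr P U u * (2 * Hb (Pr P (rv_pair U S) (u, true) / Pr P U u)
    - Hb (Pr P (rv_pair U T) (u, true) / Pr P U u) - 1) <=
  rate_envelope (Num.min (expect_bit P X) 2^-1).
Proof.
move=> Pp; set a := fun u => Pr P (rv_pair U S) (u, true) / Pr P U u.
set b := fun u => Pr P (rv_pair U T) (u, true) / Pr P U u.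
pose d u : R := Num.min `|a u - b u| 2^-1.
have d01 u : 0 <= d u <= 2^-1.
  by rewrite /d le_min ge_min normr_ge0 lexx orbT/= andbT invr_ge0.
have U0 u : 0 <= Pr P U u by exact: Pr_ge0.
apply: le_trans (_ : \sum_u Pr P U u * rate_envelope (d u) <= _).
  apply: ler_sum => u _; rewrite ler_wpM2l//.
  by apply: encoder_bound; exact: Pr_ratio01.
have [/andP[D0 D1] DE] :=
  concave_on_jensen (@rate_envelope_concave R) U0 (sum_Pr U Pp) d01.
apply: (le_trans DE); apply: rate_envelope_nondecreasing => //.
  rewrite le_min D1 andbT expect_bitE (Pr_snd P U X).
  apply: ler_sum => u _; apply: le_trans (cost_ge U S X u Pp).
  by rewrite ler_wpM2l// /d ge_min lexx.
by rewrite ge_min lexx orbT.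
Qed.

(** The conditional factorization of the encoders combines with the independence of the states;
    uniformity makes every conditioning event have positive probability. *)
Lemma dd_law_users_indep {R : realType} (L : dd_law R) :
  indep (@dd_pmf R L) (rv_pair (rv_pair (@U1 R L) (@X1 R L)) (@S1 R L))
                      (rv_pair (rv_pair (@U2 R L) (@X2 R L)) (@S2 R L)).
Proof.
move=> [[u1 x1] s1] [[u2 x2] s2]; have := @encoders R L u1 u2 x1 x2 s1 s2.
rewrite /cPr S_indep S1_unif S2_unif => e.
have -> : Pr (@dd_pmf R L) (rv_pair (rv_pair (rv_pair (@U1 R L) (@X1 R L)) (@S1 R L))
    (rv_pair (rv_pair (@U2 R L) (@X2 R L)) (@S2 R L))) ((u1, x1, s1), (u2, x2, s2)) =
  Pr (@dd_pmf R L) (rv_pair (rv_pair (rv_pair (@U1 R L) (@X1 R L))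
    (rv_pair (@U2 R L) (@X2 R L))) (rv_pair (@S1 R L) (@S2 R L)))
    ((u1, x1), (u2, x2), (s1, s2)).
  by apply: eq_bigl => w; rewrite /rv_pair !xpair_eqE; do !case: (_ == _).
apply: (mulIf (_ : (2^-1 / 2)^-1 != 0)); first by rewrite invr_eq0; lra.
by rewrite e; field.
Qed.

(** With H(Y) at most 1 and H(Y|U1,U2) at least the mean of H(T1|U1) and H(T2|U2), the sum rate is
    at most half the sum of the two left sides of [user_bound]. *)
Lemma law_sum_rate_le {R : realType} (L : dd_law R) :
  MI (@dd_pmf R L) (rv_pair (@U1 R L) (@U2 R L)) (@dd_Y R L)
    - MI (@dd_pmf R L) (@U1 R L) (@S1 R L) - MI (@dd_pmf R L) (@U2 R L) (@S2 R L) <=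
  2^-1 * (rate_envelope (Num.min (expect_bit (@dd_pmf R L) (@X1 R L)) 2^-1) +
          rate_envelope (Num.min (expect_bit (@dd_pmf R L) (@X2 R L)) 2^-1)).
Proof.
have Pp := pmfP L; set P := @dd_pmf R L.
pose T1 w := @X1 R L w (+) @S1 R L w; pose T2 w := @X2 R L w (+) @S2 R L w.
have b1 := user_bound (@U1 R L) (@S1 R L) (@X1 R L) Pp.
have b2 := user_bound (@U2 R L) (@S2 R L) (@X2 R L) Pp.
apply: le_trans (ler_wpM2l _ (lerD b1 b2)); last by rewrite invr_ge0.
rewrite !MI_boolE// -/P S1_unif S2_unif Hb_half {b1 b2}.
set U := rv_pair _ _; set Y := @dd_Y R L.
have Y1 : Hb (Pr P Y true) <= 1.
  by apply: Hb_le1; rewrite Pr_ge0//= -(sum_Pr Y Pp) big_bool lerDl Pr_ge0.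
have TI : indep P (rv_pair (@U1 R L) T1) (rv_pair (@U2 R L) T2).
  exact: (indep_comp P _ _ (fun v => (v.1.1, v.1.2 (+) v.2))
    (fun v => (v.1.1, v.1.2 (+) v.2)) (dd_law_users_indep L)).
have UI : indep P (@U1 R L) (@U2 R L) by exact: (indep_comp P _ _ fst fst TI).
have YE u1 u2 : Pr P (rv_pair U Y) ((u1, u2), true) =
    Pr P (rv_pair (@U1 R L) T1) (u1, true) * Pr P (rv_pair (@U2 R L) T2) (u2, false) +
    Pr P (rv_pair (@U1 R L) T1) (u1, false) * Pr P (rv_pair (@U2 R L) T2) (u2, true).
  rewrite -!TI !PrE -big_split/=; apply: eq_bigr => w _; rewrite -mulrDr; congr (_ * _).
  rewrite /U /Y /dd_Y /rv_pair /T1 /T2 !xpair_eqE.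
  by case: (_ == u1); case: (_ == u2); case: (X1 w); case: (X2 w); case: (S1 w);
    case: (S2 w); rewrite /= ?addr0 ?add0r.
set p1 := Pr P (@U1 R L); set p2 := Pr P (@U2 R L).
set t1 := fun u => Pr P (rv_pair (@U1 R L) T1) (u, true) / p1 u.
set t2 := fun u => Pr P (rv_pair (@U2 R L) T2) (u, true) / p2 u.
have s1 : \sum_u p1 u = 1 by exact: sum_Pr.
have s2 : \sum_u p2 u = 1 by exact: sum_Pr.
have p10 u : 0 <= p1 u by exact: Pr_ge0.
have p20 u : 0 <= p2 u by exact: Pr_ge0.
(* Given [(U1, U2)], the output is the sum of independent bits [T1] and [T2], so its entropy
   dominates each of theirs and hence their mean. *)
have key : 2^-1 * (\sum_u p1 u * Hb (t1 u) + \sum_u p2 u * Hb (t2 u)) <=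
    \sum_u Pr P U u * Hb (Pr P (rv_pair U Y) (u, true) / Pr P U u).
  have -> : \sum_u p1 u * Hb (t1 u) = \sum_u1 \sum_u2 p1 u1 * p2 u2 * Hb (t1 u1).
    apply: eq_bigr => u1 _; rewrite -mulr_suml -mulr_sumr s2; ring.
  have -> : \sum_u p2 u * Hb (t2 u) = \sum_u1 \sum_u2 p1 u1 * p2 u2 * Hb (t2 u2).
    rewrite exchange_big; apply: eq_bigr => u2 _.
    by rewrite -mulr_suml -mulr_suml s1 mul1r.
  rewrite !pair_bigA/= -big_split/= mulr_sumr; apply: ler_sum => -[u1 u2] _ /=.
  rewrite UI YE -/(p1 u1) -/(p2 u2).
  have [z1|n1] := eqVneq (p1 u1) 0; first by rewrite z1 !mul0r addr0 mulr0.
  have [z2|n2] := eqVneq (p2 u2) 0; first by rewrite z2 !(mulr0, mul0r) addr0 mulr0.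
  have g1 : Pr P (rv_pair (@U1 R L) T1) (u1, true) = p1 u1 * t1 u1.
    by rewrite mulrC divfK.
  have g2 : Pr P (rv_pair (@U2 R L) T2) (u2, true) = p2 u2 * t2 u2.
    by rewrite mulrC divfK.
  have f1 : Pr P (rv_pair (@U1 R L) T1) (u1, false) = p1 u1 * (1 - t1 u1).
    by rewrite mulrBr mulr1 -g1 /p1 [X in _ = X - _](Pr_fst_bool P _ T1) addrC addKr.
  have f2 : Pr P (rv_pair (@U2 R L) T2) (u2, false) = p2 u2 * (1 - t2 u2).
    by rewrite mulrBr mulr1 -g2 /p2 [X in _ = X - _](Pr_fst_bool P _ T2) addrC addKr.
  have r1 : 0 <= t1 u1 <= 1 by exact: Pr_ratio01.
  have r2 : 0 <= t2 u2 <= 1 by exact: Pr_ratio01.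
  rewrite f1 f2 g1 g2; move: (t1 u1) (t2 u2) r1 r2 => x y x01 y01.
  have -> : (p1 u1 * x * (p2 u2 * (1 - y)) + p1 u1 * (1 - x) * (p2 u2 * y)) /
    (p1 u1 * p2 u2) = x * (1 - y) + (1 - x) * y by field; rewrite n1 n2.
  have hy := Hb_binary_convolution x y x01 y01.
  have hx := Hb_binary_convolution y x y01 x01.
  have := mulr_ge0 (p10 u1) (p20 u2).
  have e : y * (1 - x) + (1 - y) * x = x * (1 - y) + (1 - x) * y by ring.
  by rewrite e in hx; nra.
have expand (A : finType) (p f g : A -> R) : \sum_u p u = 1 ->
    \sum_u p u * (2 * f u - g u - 1) = 2 * \sum_u p u * f u - \sum_u p u * g u - 1.
  move=> s; rewrite -[X in _ = _ - X]s mulr_sumr -!sumrB; apply: eq_bigr => u _; ring.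
rewrite !expand// -/T1 -/T2 -/(t1 _) -/(t2 _); move: key Y1; rewrite /t1 /t2; lra.
Qed.

(** A second use of Jensen's inequality, over the time-sharing phases: once for each user under its
    own constraint, after which the two bounds are averaged. *)
Lemma time_shared_sum_le {R : realType} (q : R) (r : R * R) : q <= 2^-1 ->
  time_shared q r -> r.1 + r.2 <= rate_envelope q.
Proof.
move=> q1 [k [lam [L [p [[lam0 lam1] pP c1 c2 ->]]]]] /=.
have user (c : 'I_k -> R) : (forall j, 0 <= c j) -> \sum_j lam j * c j <= q ->
    \sum_j lam j * rate_envelope (Num.min (c j) 2^-1) <= rate_envelope q.
  move=> c0 cq.
  have m01 j : 0 <= Num.min (c j) 2^-1 <= 2^-1.
    by rewrite le_min ge_min c0 lexx orbT/= andbT invr_ge0.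
  have [/andP[D0 D1] DE] := concave_on_jensen (@rate_envelope_concave R) lam0 lam1 m01.
  apply: (le_trans DE); apply: rate_envelope_nondecreasing => //.
  apply: le_trans cq; apply: ler_sum => j _.
  by rewrite ler_wpM2l// ge_min lexx.
have e0 (j : 'I_k) X : 0 <= expect_bit (@dd_pmf R (L j)) X.
  by rewrite expect_bitE; apply: Pr_ge0; exact: pmfP.
have := lerD (user _ (fun j => e0 j _) c1) (user _ (fun j => e0 j _) c2).
rewrite -big_split/= -big_split/= => h.
apply: le_trans (_ : 2^-1 * (rate_envelope q + rate_envelope q) <= _); last by lra.
apply: le_trans (ler_wpM2l _ h); last by rewrite invr_ge0.
rewrite mulr_sumr; apply: ler_sum => j _.
rewrite -!mulrDr mulrCA ler_wpM2l//; have [_ _ _ _ s] := pP j.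
exact: le_trans s (law_sum_rate_le (L j)).
Qed.

(** * Achievability *)

Definition prod_pmf {R : realType} {V1 V2 : finType} (P1 : V1 -> R) (P2 : V2 -> R)
  (w : V1 * V2) : R := P1 w.1 * P2 w.2.

Lemma prod_pmfP {R : realType} {V1 V2 : finType} {P1 : V1 -> R} {P2 : V2 -> R} :
  is_pmf P1 -> is_pmf P2 -> is_pmf (prod_pmf P1 P2).
Proof.
move=> [P10 P11] [P20 P21]; split=> [w|]; first exact: mulr_ge0.
rewrite -(pair_bigA _ (fun v1 v2 => P1 v1 * P2 v2))/= -[RHS]P11.
by apply: eq_bigr => v _; rewrite -mulr_sumr P21 mulr1.
Qed.

Lemma Pr_prod {R : realType} {V1 V2 : finType} (P1 : V1 -> R) (P2 : V2 -> R)
    {A B : eqType} (X : V1 -> A) (Y : V2 -> B) a b :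
  Pr (prod_pmf P1 P2) (rv_pair (X \o fst) (Y \o snd)) (a, b) = Pr P1 X a * Pr P2 Y b.
Proof.
by rewrite /Pr big_distrlr/= pair_big/=; apply: eq_bigl => w; rewrite xpair_eqE.
Qed.

Lemma Pr_prod_fst {R : realType} {V1 V2 : finType} (P1 : V1 -> R) (P2 : V2 -> R)
    {A : eqType} (X : V1 -> A) a : is_pmf P2 ->
  Pr (prod_pmf P1 P2) (X \o fst) a = Pr P1 X a.
Proof.
move=> [_ P21]; rewrite !PrE.
rewrite -(pair_bigA _ (fun v1 v2 => P1 v1 * P2 v2 * (X v1 == a)%:R))/=.
by apply: eq_bigr => v _; rewrite -mulr_suml -mulr_sumr P21 mulr1.
Qed.

Lemma Pr_prod_snd {R : realType} {V1 V2 : finType} (P1 : V1 -> R) (P2 : V2 -> R)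
    {A : eqType} (Y : V2 -> A) a : is_pmf P1 ->
  Pr (prod_pmf P1 P2) (Y \o snd) a = Pr P2 Y a.
Proof.
move=> [_ P11]; rewrite !PrE.
rewrite -(pair_bigA _ (fun v1 v2 => P1 v1 * P2 v2 * (Y v2 == a)%:R))/=.
rewrite exchange_big; apply: eq_bigr => v _.
by rewrite -mulr_suml -mulr_suml P11 mul1r.
Qed.

(* [v] is the pair [(S, X)] of one user. *)
Definition user_pmf {R : realType} (t : R) (v : bool * bool) : R :=
  2^-1 * (if v.2 then t else 1 - t).

Lemma sum_bool2 {R : realType} (F : bool * bool -> R) :
  \sum_v F v = F (true, true) + F (true, false) + (F (false, true) + F (false, false)).
Proof.
rewrite (eq_bigr (fun v => F (v.1, v.2))) => [|[]//].
by rewrite -(pair_bigA _ (fun a b => F (a, b)))/= !big_bool.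
Qed.

Lemma user_pmfP {R : realType} {t : R} : 0 <= t <= 1 -> is_pmf (user_pmf t).
Proof.
move=> t01; split=> [[s x]|]; first by rewrite /user_pmf/=; case: x; lra.
by rewrite sum_bool2 /user_pmf/=; lra.
Qed.

Lemma user_pmf_S {R : realType} (t : R) s : Pr (user_pmf t) fst s = 2^-1.
Proof. by rewrite PrE sum_bool2 /user_pmf; case: s => /=; lra. Qed.

Lemma user_pmf_X {R : realType} (t : R) : Pr (user_pmf t) snd true = t.
Proof. by rewrite PrE sum_bool2 /user_pmf/=; lra. Qed.

Lemma prod_pmf_encoders {R : realType} {V1 V2 : finType} {P1 : V1 -> R}
    {P2 : V2 -> R} {B1 B2 C1 C2 : eqType} (E1 : V1 -> B1) (E2 : V2 -> B2)
    (F1 : V1 -> C1) (F2 : V2 -> C2) e1 e2 f1 f2 : is_pmf P1 -> is_pmf P2 ->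
  cPr (prod_pmf P1 P2) (rv_pair (E1 \o fst) (E2 \o snd))
    (rv_pair (F1 \o fst) (F2 \o snd)) (e1, e2) (f1, f2) =
  cPr (prod_pmf P1 P2) (E1 \o fst) (F1 \o fst) e1 f1 *
  cPr (prod_pmf P1 P2) (E2 \o snd) (F2 \o snd) e2 f2.
Proof.
move=> P1p P2p; rewrite /cPr.
have -> : Pr (prod_pmf P1 P2) (rv_pair (rv_pair (E1 \o fst) (E2 \o snd))
      (rv_pair (F1 \o fst) (F2 \o snd))) ((e1, e2), (f1, f2)) =
    Pr (prod_pmf P1 P2) (rv_pair (rv_pair E1 F1 \o fst) (rv_pair E2 F2 \o snd))
      ((e1, f1), (e2, f2)).
  by apply: eq_bigl => w; rewrite /rv_pair/= !xpair_eqE; do !case: (_ == _).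
rewrite !Pr_prod -mulf_div (Pr_prod_fst _ _ F1)// (Pr_prod_snd _ _ F2)//.
congr (_ / _ * (_ / _)).
- by rewrite -(Pr_prod_fst P1 P2).
- by rewrite -(Pr_prod_snd P1 P2).
Qed.

Lemma test_channel_S1 {R : realType} {t : R} (t01 : 0 <= t <= 1) s :
  Pr (prod_pmf (user_pmf t) (user_pmf t)) (fst \o fst) s = 2^-1.
Proof. by rewrite (Pr_prod_fst _ _ fst _ (user_pmfP t01)) user_pmf_S. Qed.

Lemma test_channel_S2 {R : realType} {t : R} (t01 : 0 <= t <= 1) s :
  Pr (prod_pmf (user_pmf t) (user_pmf t)) (fst \o snd) s = 2^-1.
Proof. by rewrite (Pr_prod_snd _ _ fst _ (user_pmfP t01)) user_pmf_S. Qed.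

Lemma test_channel_S_indep {R : realType} {t : R} (t01 : 0 <= t <= 1) :
  indep (prod_pmf (user_pmf t) (user_pmf t)) (fst \o fst) (fst \o snd).
Proof.
by move=> s1 s2; rewrite Pr_prod (test_channel_S1 t01) (test_channel_S2 t01) !user_pmf_S.
Qed.

(** The map [phi] from [(S, X)] to the auxiliary variable is left free so that one construction
    serves both the Costa-type scheme and the idle channel. *)
Definition test_channel {R : realType} {t : R} (t01 : 0 <= t <= 1)
    {A : finType} (phi : bool * bool -> A) : dd_law R :=
  @DDLaw R (bool * bool * (bool * bool))%type
    (prod_pmf (user_pmf t) (user_pmf t)) A A (fst \o fst) (fst \o snd)
    (phi \o fst) (phi \o snd) (snd \o fst) (snd \o snd)
    (prod_pmfP (user_pmfP t01) (user_pmfP t01))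
    (test_channel_S1 t01) (test_channel_S2 t01) (test_channel_S_indep t01)
    (fun u1 u2 x1 x2 s1 s2 =>
      prod_pmf_encoders (rv_pair phi snd) (rv_pair phi snd) fst fst
        (u1, x1) (u2, x2) s1 s2 (user_pmfP t01) (user_pmfP t01)).

Lemma test_channel_cost {R : realType} {t : R} (t01 : 0 <= t <= 1) {A : finType}
    (phi : bool * bool -> A) (L := test_channel t01 phi) :
  expect_bit (@dd_pmf R L) (@X1 R L) = t /\ expect_bit (@dd_pmf R L) (@X2 R L) = t.
Proof.
have uP := user_pmfP t01; split; rewrite expect_bitE.
  by rewrite (Pr_prod_fst (user_pmf t) (user_pmf t) snd true uP) user_pmf_X.
by rewrite (Pr_prod_snd (user_pmf t) (user_pmf t) snd true uP) user_pmf_X.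
Qed.

(** * Rates of the idle channel and of the Costa-type scheme *)

Lemma MI_cst {R : realType} {W : finType} {P : W -> R} {A : finType} (a : A)
    (Y : W -> bool) : is_pmf P -> MI P (fun=> a) Y = 0.
Proof.
move=> Pp; rewrite MI_boolE//.
rewrite (sum_Pr_mul P (fun=> a)
  (fun u => Hb (Pr P (rv_pair (fun=> a) Y) (u, true) / Pr P (fun=> a) u))).
have Pa : Pr P (fun=> a) a = 1.
  by rewrite PrE -[RHS]Pp.2; apply: eq_bigr => w _; rewrite eqxx mulr1.
have PaY : Pr P (rv_pair (fun=> a) Y) (a, true) = Pr P Y true.
  by apply: eq_bigl => w; rewrite xpair_eqE eqxx.
by rewrite -mulr_suml Pp.2 Pa PaY divr1 mul1r subrr.
Qed.

Lemma cMI_cst {R : realType} {W : finType} {P : W -> R} (Y : W -> bool) :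
  is_pmf P -> cMI P (fun=> tt) Y (fun=> tt) = 0.
Proof.
move=> Pp; rewrite /cMI; apply: big1 => -[] _; apply: big1 => b _; apply: big1 => -[] _.
have e1 : Pr P (rv_pair (rv_pair (fun=> tt) Y) (fun=> tt)) (tt, b, tt) = Pr P Y b.
  by apply: eq_bigl => w; rewrite !xpair_eqE !eqxx andbT.
have e2 : Pr P (rv_pair Y (fun=> tt)) (b, tt) = Pr P Y b.
  by apply: eq_bigl => w; rewrite !xpair_eqE !eqxx andbT.
have e3 : Pr P (rv_pair (fun=> tt) (fun=> tt)) (tt, tt) = 1.
  by rewrite -[RHS]Pp.2; apply: eq_bigl => w; rewrite eqxx.
have e4 : Pr P (fun=> tt) tt = 1.
  by rewrite -[RHS]Pp.2; apply: eq_bigl => w; rewrite eqxx.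
rewrite /cPr e1 e2 e3 e4 !divr1 mul1r.
have [->|n0] := eqVneq (Pr P Y b) 0; first by rewrite mul0r.
by rewrite divff// log2_1 mulr0.
Qed.

Lemma idle_pentagon {R : realType} (t01 : 0 <= (0 : R) <= 1) :
  pentagon (test_channel t01 (fun=> tt)) (0, 0).
Proof.
set L := test_channel _ _; have Pp := pmfP L.
have U1E : @U1 R L = (fun=> tt) by [].
have U2E : @U2 R L = (fun=> tt) by [].
have UE : rv_pair (@U1 R L) (@U2 R L) = (fun=> (tt, tt)) by [].
rewrite /pentagon /mkset UE U1E U2E.
rewrite (@cMI_cst _ _ _ _ Pp) !MI_cst//.
by rewrite !subr0 addr0; split.
Qed.

(** The sum is a fair bit and is determined by the pair. *)
Lemma MI_fair_xor {R : realType} {W : finType} {P : W -> R} (A B : W -> bool) :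
  is_pmf P -> (forall ab, Pr P (rv_pair A B) ab = 4^-1) ->
  MI P (rv_pair A B) (fun w => A w (+) B w) = 1.
Proof.
move=> Pp AB.
have V (D : eqType) (f : bool * bool -> D) d :
    Pr P (f \o rv_pair A B) d = \sum_v 4^-1 * (f v == d)%:R.
  rewrite Pr_comp big_mkcond; apply: eq_bigr => v _.
  by rewrite AB; case: eqP; rewrite ?mulr1 ?mulr0.
have Y1 : Pr P (fun w => A w (+) B w) true = 2^-1.
  by rewrite (V _ (fun v => v.1 (+) v.2)) sum_bool2/=; lra.
rewrite MI_boolE// Y1 Hb_half.
rewrite big1 ?subr0// => -[a b] _.
rewrite AB (V _ (fun v => (v, v.1 (+) v.2)) (a, b, true)) sum_bool2 !xpair_eqE.
case: a; case: b; rewrite /= ?(mulr0, mulr1, addr0, add0r, mul0r, Hb0)//;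
  by rewrite divff ?Hb1 ?mulr0// invr_eq0 pnatr_eq0.
Qed.

(** Once [B] is known, the sum and [A] determine each other, and [A] is still fair. *)
Lemma cMI_fair_xor {R : realType} {W : finType} {P : W -> R} (A B : W -> bool) :
  is_pmf P -> (forall ab, Pr P (rv_pair A B) ab = 4^-1) ->
  cMI P A (fun w => A w (+) B w) B = 1.
Proof.
move=> Pp AB.
have V (D : eqType) (f : bool * bool -> D) d :
    Pr P (f \o rv_pair A B) d = \sum_v 4^-1 * (f v == d)%:R.
  rewrite Pr_comp big_mkcond; apply: eq_bigr => v _.
  by rewrite AB; case: eqP; rewrite ?mulr1 ?mulr0.
have PB b : Pr P B b = 2^-1.
  by rewrite (V _ snd) sum_bool2/=; case: b => /=; lra.
have PYB y b : Pr P (rv_pair (fun w => A w (+) B w) B) (y, b) = 4^-1.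
  rewrite (V _ (fun v => (v.1 (+) v.2, v.2))) sum_bool2 !xpair_eqE.
  by case: y; case: b => /=; lra.
have P3 a y b : Pr P (rv_pair (rv_pair A (fun w => A w (+) B w)) B) (a, y, b) =
    4^-1 * (a (+) b == y)%:R.
  rewrite (V _ (fun v => (v.1, v.1 (+) v.2, v.2))) sum_bool2 !xpair_eqE.
  by case: a; case: y; case: b => /=; lra.
(* The ratio inside the logarithm for the four triples of positive weight; each contributes 1/4. *)
have l2 : 4^-1 * 1 / 2^-1 / (4^-1 / 2^-1 * (4^-1 / 2^-1)) = 2 :> R by field.
rewrite /cMI /cPr.
under eq_bigr => a _ do under eq_bigr => y _ do
  under eq_bigr => b _ do rewrite P3 PYB AB PB.
by rewrite !big_bool/= l2 log2_2; lra.
Qed.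

(* Costa-type scheme [U = S (+) X]: [U] is fair and [S] equals [U] up to a
   Bernoulli[(t)] error, while the output is [U1 (+) U2]. *)
Lemma xor_pentagon {R : realType} (t : R) (t01 : 0 <= t <= 1) (r : R * R) :
  0 <= r.1 -> 0 <= r.2 -> r.1 + r.2 <= 2 * Hb t - 1 ->
  pentagon (test_channel t01 (fun v => v.1 (+) v.2)) r.
Proof.
move=> r1 r2 r12; set L := test_channel _ _; have Pp := pmfP L.
have uP := user_pmfP t01; set Q := user_pmf t in uP.
have QU u : Pr Q (fun v => v.1 (+) v.2) u = 2^-1.
  by rewrite PrE sum_bool2 /Q /user_pmf; case: u => /=; lra.
have UU ab : Pr (@dd_pmf R L) (rv_pair (@U1 R L) (@U2 R L)) ab = 4^-1.
  case: ab => a b; apply: etrans (Pr_prod Q Q _ _ a b) _.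
  by rewrite !QU; field.
have UU' ab : Pr (@dd_pmf R L) (rv_pair (@U2 R L) (@U1 R L)) ab = 4^-1.
  case: ab => a b; rewrite -(UU (b, a)); apply: eq_bigl => w.
  by rewrite !xpair_eqE andbC.
have YE : @dd_Y R L = (fun w => @U1 R L w (+) @U2 R L w).
  by apply/funext => -[[s1 x1] [s2 x2]]; rewrite /dd_Y /=;
    case: s1; case: s2; case: x1; case: x2.
have YE' : @dd_Y R L = (fun w => @U2 R L w (+) @U1 R L w).
  by rewrite YE; apply/funext => w; rewrite addbC.
have QS u : Pr Q (rv_pair (fun v => v.1 (+) v.2) fst) (u, true) / 2^-1 =
    if u then 1 - t else t.
  rewrite PrE sum_bool2 /Q /user_pmf !xpair_eqE.
  by case: u => /=; field.
have M1 : MI (@dd_pmf R L) (@U1 R L) (@S1 R L) = 1 - Hb t.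
  rewrite MI_boolE// S1_unif Hb_half; congr (_ - _).
  rewrite (eq_bigr (fun=> 2^-1 * Hb t)) => [|u _]; first by rewrite big_bool/=; lra.
  rewrite (etrans (Pr_prod_fst Q Q (fun v => v.1 (+) v.2) u uP) (QU u)).
  rewrite (etrans (congr1 (fun x => x / 2^-1) (Pr_prod_fst Q Q
    (rv_pair (fun v => v.1 (+) v.2) fst) (u, true) uP)) (QS u)).
  by case: u; rewrite ?HbC.
have M2 : MI (@dd_pmf R L) (@U2 R L) (@S2 R L) = 1 - Hb t.
  rewrite MI_boolE// S2_unif Hb_half; congr (_ - _).
  rewrite (eq_bigr (fun=> 2^-1 * Hb t)) => [|u _]; first by rewrite big_bool/=; lra.
  rewrite (etrans (Pr_prod_snd Q Q (fun v => v.1 (+) v.2) u uP) (QU u)).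
  rewrite (etrans (congr1 (fun x => x / 2^-1) (Pr_prod_snd Q Q
    (rv_pair (fun v => v.1 (+) v.2) fst) (u, true) uP)) (QS u)).
  by case: u; rewrite ?HbC.
(* The individual constraints allow each rate up to [Hb t]; they follow from the sum constraint
   because [2 * Hb t - 1 <= Hb t]. *)
have h1 := Hb_le1 t t01.
rewrite /pentagon /= -/L M1 M2; split=> //.
- by rewrite YE cMI_fair_xor//; lra.
- by rewrite YE' cMI_fair_xor//; lra.
- by rewrite YE MI_fair_xor//; lra.
Qed.

(** The active scheme at cost [t] runs for the fraction [l = q / t] of the time, so the average cost
    is exactly [q], and its rates are scaled up by [1 / l]. *)
Lemma time_shared_triangle {R : realType} (q : R) (r : R * R) :
  0 <= q -> q <= 2^-1 -> 0 <= r.1 -> 0 <= r.2 -> r.1 + r.2 <= rate_envelope q ->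
  time_shared q r.
Proof.
move=> q0 q1 r1 r2 r12; have /andP[b1 b2] := @qstar_bounds R.
pose t := Num.max q qstar.
have tq : q <= t by rewrite le_max lexx.
have t0 : 0 < t by rewrite lt_max; lra.
have t01 : 0 <= t <= 1 by rewrite (ltW t0) ge_max; lra.
have z01 : 0 <= (0 : R) <= 1 by rewrite lexx ler01.
pose l := q / t.
have l0 : 0 <= l by rewrite divr_ge0// ltW.
have l1 : l <= 1 by rewrite ler_pdivrMr// mul1r.
have lt : l * t = q by rewrite divfK// gt_eqF.
have rl := le_trans r12 (rate_envelope_le q t q0 q1 erefl).
(* Ensures [2 * Hb t - 1 >= 0], so that the active pentagon contains the pair [(0, 0)] used when
   [l = 0]. *)
have Ht : 2 / 3 <= Hb t.
  apply: le_trans (Hb_qstar_le_middle t _); first exact: Hb_qstar_ge.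
  by rewrite le_max lexx orbT /t lerBrDr -lerBrDr ge_max; lra.
rewrite -/l in rl; clearbody l t.
(* If [l = 0], the sum bound forces both rates to be 0, in agreement with the default value of
   division by 0. *)
have rE (x : R) : 0 <= x -> x <= r.1 + r.2 -> l * (x / l) = x.
  move=> x0 xr; have [lz|ln0] := eqVneq l 0; last by rewrite mulrC divfK.
  by rewrite lz mul0r in rl; rewrite lz; lra.
exists 2, (fun j => if j == ord0 then l else 1 - l),
  (fun j => if j == ord0 then test_channel t01 (fun v => v.1 (+) v.2)
            else test_channel z01 (fun=> tt)),
  (fun j => if j == ord0 then (r.1 / l, r.2 / l) else (0, 0)).
have [c1 c2] := test_channel_cost t01 (fun v => v.1 (+) v.2).
have [d1 d2] := test_channel_cost z01 (fun=> tt).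
split.
- split=> [j|]; first by case: ifP => _ //; rewrite subr_ge0.
  by rewrite !big_ord_recl big_ord0/= addr0 addrC subrK.
- move=> j; case: ifP => _; last exact: idle_pentagon.
  apply: xor_pentagon => /=; try by rewrite divr_ge0.
  have [lz|ln0] := eqVneq l 0.
    by rewrite lz !invr0 !mulr0 addr0; lra.
  by rewrite -mulrDl ler_pdivrMr ?lt_neqAle ?l0 1?eq_sym ?ln0// mulrC.
- by rewrite !big_ord_recl big_ord0/= c1 d1 mulr0 !addr0 lt.
- by rewrite !big_ord_recl big_ord0/= c2 d2 mulr0 !addr0 lt.
- rewrite !big_ord_recl !big_ord0/= !mulr0 !addr0 !rE ?lerDl ?lerDr//.
  by case: r {r1 r2 r12 rl rE}.
Qed.

Theorem theorem2 (R : realType) (q : R)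
    (q_ge0 : 0 <= q) (q_le_half : q <= 2^-1) :
  R_BSL q =
  [set r : R * R |
    [/\ 0 <= r.1, 0 <= r.2 &
        r.1 + r.2 <= uce `[0, 2^-1] (fun x : R => pos_part (2 * Hb x - 1)) q]].
Proof.
(* The time-shared set already equals the triangle before the closure is taken. *)
have -> : R_BSL q = closure [set r : R * R |
    [/\ 0 <= r.1, 0 <= r.2 & r.1 + r.2 <= rate_envelope q]].
  congr (closure _); apply/seteqP; split=> [r rq|r [r1 r2 r12]]; last first.
    exact: time_shared_triangle.
  split; last exact: time_shared_sum_le.
  - case: rq => k [lam [L [p [[lam0 _] pP _ _ ->]]]] /=.
    by apply: sumr_ge0 => j _; rewrite mulr_ge0//; have [] := pP j.
  - case: rq => k [lam [L [p [[lam0 _] pP _ _ ->]]]] /=.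
    by apply: sumr_ge0 => j _; rewrite mulr_ge0//; have [] := pP j.
(* It remains to see that the triangle is closed: it is an intersection of preimages of closed
   half-lines under continuous maps. *)
apply/esym/(closure_id _).1.
have -> : [set r : R * R | [/\ 0 <= r.1, 0 <= r.2 & r.1 + r.2 <= rate_envelope q]] =
    (fst @^-1` [set x : R | 0 <= x]) `&` (snd @^-1` [set x : R | 0 <= x]) `&`
    ((fun r => r.1 + r.2) @^-1` [set x : R | x <= rate_envelope q]).
  by apply/seteqP; split=> r /= => [[? ? ?]|[[? ?] ?]].
apply: closedI; first apply: closedI.
- by apply: preimage_closed; [move=> x _; exact: cvg_fst|exact: closed_ge].
- by apply: preimage_closed; [move=> x _; exact: cvg_snd|exact: closed_ge].
- apply: preimage_closed; last exact: closed_le.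
  by move=> x _; apply: cvgD; [exact: cvg_fst|exact: cvg_snd].
Qed.
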